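(* Let $\tilde V:\mathbb{R}^2\setminus\{0\}\to\mathbb{R}$ be a smooth radially invariant potential, i.e. $\tilde V(\lambda x)=\tilde V(x)$ for all $\lambda>0$ and $x\in\mathbb{R}^2\setminus\{0\}$. Then for every real number $E$ with $E>\max\tilde V$ there exists a radius $r_E\in\mathbb{R}^+$ such that on the circle $\partial B_{r_E}(0)$ there exists an energy eigenstate for energy $E$ of the Hamiltonian operator $$\hat H\psi=-\frac{1}{r_E^2}\frac{\mathrm{d}^2}{\mathrm{d}\varphi^2}\psi+V\cdot\psi,$$ where $V$ is the restriction of $\tilde V$ to $\partial B_{r_E}(0)$.
   Context: Units are chosen so that $\hbar^2/(2m)=1$. Here $S^1=\mathbb{R}/\mathbb{Z}$ with coordinate $\varphi$ of period $1$, and the circle $\partial B_r(0)=\{x\in\mathbb{R}^2: \|x\|=r\}$ is parametrized proportionally to arc length by $\varphi\in S^1$, so $V(\varphi)=\tilde V(r\cos 2\pi\varphi,\,r\sin 2\pi\varphi)$. The operator $\hat H$ is regarded as an unbounded operator on $L^2(S^1,\mathbb{C})$ with a suitable dense domain of (twice differentiable) functions on $S^1$, i.e. periodic functions. An energy eigenstate for energy $E$ is a nonzero function $\psi:S^1\to\mathbb{C}$ in this domain with $-\frac{1}{r^2}\psi''+V\psi=E\psi$. *)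

(* Defs.v *)
From Stdlib Require Import Reals.
From Coquelicot Require Import Coquelicot.
Open Scope R_scope.

(* Functions on the punctured plane are total curried functions R -> R -> R
   whose value at the origin is never used. *)
Definition punctured_plane (x y : R) : Prop := (x, y) <> (0, 0).

(* [ex_diff_n f n x y]: all iterated partial derivatives of order at most n
   exist and are continuous at (x, y). *)
Definition smooth_on (D : R -> R -> Prop) (f : R -> R -> R) : Prop :=
  forall (n : nat) (x y : R), D x y -> ex_diff_n f n x y.

Definition radially_invariant (f : R -> R -> R) : Prop :=
  forall lambda x y : R, 0 < lambda -> punctured_plane x y ->
    f (lambda * x) (lambda * y) = f x y.

Definition is_max_on (D : R -> R -> Prop) (f : R -> R -> R) (M : R) : Prop :=
  (exists x y : R, D x y /\ f x y = M) /\
  (forall x y : R, D x y -> f x y <= M).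

Definition circle_restriction (r : R) (f : R -> R -> R) (phi : R) : R :=
  f (r * cos (2 * PI * phi)) (r * sin (2 * PI * phi)).

(* Functions on S^1 = R/Z are functions on R of period 1. *)
Definition periodic1 (psi : R -> C) : Prop :=
  forall phi : R, psi (phi + 1) = psi phi.

Definition C_ex_derive (psi : R -> C) (phi : R) : Prop :=
  @ex_derive R_AbsRing C_R_NormedModule psi phi.

(* Coquelicot's [Derive] is only for real-valued functions, hence the
   componentwise definition; [C_derive_correct] relates it to [is_derive]. *)
Definition C_derive_R (psi : R -> C) (phi : R) : C :=
  (Derive (fun t => Re (psi t)) phi, Derive (fun t => Im (psi t)) phi).

Lemma C_derive_correct (psi : R -> C) (phi : R) :
  C_ex_derive psi phi ->
  @is_derive R_AbsRing C_R_NormedModule psi phi (C_derive_R psi phi).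
Proof.
  intros [[a b] H].
  assert (Ha : Derive (fun t => Re (psi t)) phi = a).
  { apply is_derive_unique.
    eapply filterdiff_ext_lin.
    - apply (@filterdiff_comp' R_AbsRing R_NormedModule C_R_NormedModule
               R_NormedModule psi fst phi _ fst H).
      apply filterdiff_linear, is_linear_fst.
    - reflexivity. }
  assert (Hb : Derive (fun t => Im (psi t)) phi = b).
  { apply is_derive_unique.
    eapply filterdiff_ext_lin.
    - apply (@filterdiff_comp' R_AbsRing R_NormedModule C_R_NormedModule
               R_NormedModule psi snd phi _ snd H).
      apply filterdiff_linear, is_linear_snd.
    - reflexivity. }
  unfold C_derive_R; rewrite Ha, Hb; exact H.
Qed.

(* The domain of the Hamiltonian in L^2(S^1, C): twice differentiable
   functions on the circle. *)
Definition hamiltonian_domain (psi : R -> C) : Prop :=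
  periodic1 psi /\
  (forall phi : R, C_ex_derive psi phi) /\
  (forall phi : R, C_ex_derive (C_derive_R psi) phi).

Definition hamiltonian (r : R) (V : R -> R) (psi : R -> C) (phi : R) : C :=
  (- (RtoC (1 / r ^ 2) * C_derive_R (C_derive_R psi) phi)
   + RtoC (V phi) * psi phi)%C.

Definition energy_eigenstate (r : R) (V : R -> R) (E : R) (psi : R -> C)
  : Prop :=
  hamiltonian_domain psi /\
  (exists phi : R, psi phi <> RtoC 0) /\
  (forall phi : R, hamiltonian r V psi phi = (RtoC E * psi phi)%C).

(* Main.v *)
(** With [M] the maximum of the potential [V] on the circle,
    [q = (E - V) / (E - M) >= 1] and [r = w / sqrt (E - M)], the eigenvalue
    equation becomes Hill's equation [u'' = - w^2 q u], and one has to find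
    [w > 0] for which it has a nonzero solution of period 1. Writing
    [u = rho sin th], [u' = w rho cos th], the Prüfer angle solves
    [th' = w (1 + (q - 1) sin^2 th)], so it advances over one period by at
    least [w] and at most [w max q]. If [th] starts at 0, the intermediate value
    theorem gives speeds at which it ends at [pi] and at [2 pi]; the trace of the
    monodromy matrix, which has determinant 1, is then [<= -2] and [>= 2]
    respectively. By continuity the trace is 2 for some [w > 0], and 1 is an
    eigenvalue of the monodromy matrix. *)

Require Import Defs.
From Stdlib Require Import Reals Lra Lia Classical.
From Coquelicot Require Import Coquelicot.
Open Scope R_scope.


(** * Global solutions of Lipschitz scalar equations *)

Lemma ex_RInt_cont (g : R -> R) (a b : R) :
  (forall t, continuous g t) -> ex_RInt g a b.
Proof. intros Hg; apply (ex_RInt_continuous (V := R_CompleteNormedModule)); auto. Qed.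

Lemma is_derive_RInt_cont (g : R -> R) (a x : R) :
  (forall t, continuous g t) -> is_derive (fun y => RInt g a y) x (g x).
Proof.
  intros Hg; apply (is_derive_RInt (V := R_NormedModule) g _ a x); [|apply Hg].
  apply filter_forall; intros y.
  now apply (RInt_correct (V := R_CompleteNormedModule)), ex_RInt_cont.
Qed.

Lemma is_derive_continuous (g : R -> R) (x l : R) : is_derive g x l -> continuous g x.
Proof. intros H; apply (ex_derive_continuous (V := R_NormedModule)); now exists l. Qed.

Lemma exp_nondecreasing (x y : R) : x <= y -> exp x <= exp y.
Proof. intros [H|H]; [apply Rlt_le; now apply exp_increasing|subst; lra]. Qed.

(** Integrating the bound gives [c / k * (exp (k * |x|) - 1)], and the [-1] is dropped. Integration
    thus keeps the exponential weight and gains a factor [1 / k], which is what the weighted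
    contraction argument uses. *)
Lemma RInt_exp_bound (g : R -> R) (c k x : R) :
  0 < k -> (forall t, continuous g t) ->
  (forall t, Rabs (g t) <= c * exp (k * Rabs t)) ->
  Rabs (RInt g 0 x) <= c / k * exp (k * Rabs x).
Proof.
  intros Hk Hg Hb.
  assert (Hc : 0 <= c / k).
  { apply Rdiv_le_0_compat; [|exact Hk].
    specialize (Hb 0); rewrite Rabs_R0, Rmult_0_r, exp_0 in Hb.
    pose proof (Rabs_pos (g 0)); lra. }
  destruct (Rle_dec 0 x) as [Hx|Hx].
  - rewrite (Rabs_pos_eq x) by exact Hx.
    apply Rle_trans with (minus (c / k * exp (k * x)) (c / k * exp (k * 0))).
    + apply (norm_RInt_le (V := R_NormedModule) g (fun t => c * exp (k * t)) 0 x); auto.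
      * intros t Ht; specialize (Hb t); rewrite (Rabs_pos_eq t) in Hb by lra; exact Hb.
      * apply (RInt_correct (V := R_CompleteNormedModule)); now apply ex_RInt_cont.
      * apply (is_RInt_derive (V := R_CompleteNormedModule) (fun t => c / k * exp (k * t))).
        -- intros t _; auto_derive; [exact I|field; lra].
        -- intros t _; apply (ex_derive_continuous (V := R_NormedModule)); auto_derive; exact I.
    + rewrite Rmult_0_r, exp_0; unfold minus, plus, opp; simpl; lra.
  (* For negative [x] the integral is reversed to run over [[x, 0]], where the weight is
     [exp (- k * t)]. *)
  - assert (Hx' : x <= 0) by lra.
    rewrite (Rabs_left1 x) by exact Hx'.
    rewrite <- (opp_RInt_swap (V := R_CompleteNormedModule)) by now apply ex_RInt_cont.
    unfold opp; simpl; rewrite Rabs_Ropp.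
    apply Rle_trans with (minus (- (c / k) * exp (- k * 0)) (- (c / k) * exp (- k * x))).
    + apply (norm_RInt_le (V := R_NormedModule) g (fun t => c * exp (- k * t)) x 0); auto.
      * intros t Ht; specialize (Hb t); rewrite (Rabs_left1 t) in Hb by lra.
        replace (- k * t) with (k * - t) by ring; exact Hb.
      * apply (RInt_correct (V := R_CompleteNormedModule)); now apply ex_RInt_cont.
      * apply (is_RInt_derive (V := R_CompleteNormedModule)
                 (fun t => - (c / k) * exp (- k * t))).
        -- intros t _; auto_derive; [exact I|field; lra].
        -- intros t _; apply (ex_derive_continuous (V := R_NormedModule)); auto_derive; exact I.
    + rewrite Rmult_0_r, exp_0; unfold minus, plus, opp; simpl.
      replace (k * - x) with (- k * x) by ring; lra.
Qed.

Fixpoint picard (f : R -> R -> R) (y0 : R) (n : nat) (x : R) : R :=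
  match n with
  | O => y0
  | S n => y0 + RInt (fun t => f t (picard f y0 n t)) 0 x
  end.

(** The form of continuity in both variables that Picard iteration consumes: along a continuous
    curve the integrand is continuous, so its integral exists and is differentiable. *)
Definition preserves_continuity (f : R -> R -> R) : Prop :=
  forall g : R -> R, (forall t, continuous g t) ->
  forall t, continuous (fun t => f t (g t)) t.

Lemma continuous_picard (f : R -> R -> R) (y0 : R) (n : nat) :
  preserves_continuity f -> forall x, continuous (picard f y0 n) x.
Proof.
  intros Hf; induction n as [|n IH]; intros x; simpl.
  - apply continuous_const.
  - apply (continuous_plus (V := R_NormedModule)); [apply continuous_const|].
    eapply is_derive_continuous, is_derive_RInt_cont; auto.
Qed.

(* The weight [exp (2 l |x|)] makes the integral operator a contraction with
   ratio 1/2 on the whole line. *)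
Lemma picard_contraction (f : R -> R -> R) (l d : R) (g h : R -> R) :
  0 < l -> preserves_continuity f ->
  (forall t a b, Rabs (f t a - f t b) <= l * Rabs (a - b)) ->
  (forall t, continuous g t) -> (forall t, continuous h t) ->
  (forall t, Rabs (g t - h t) <= d * exp (2 * l * Rabs t)) ->
  forall x, Rabs (RInt (fun t => f t (g t)) 0 x - RInt (fun t => f t (h t)) 0 x)
            <= d / 2 * exp (2 * l * Rabs x).
Proof.
  intros Hl Hf Hlip Hg Hh Hd x.
  rewrite <- (RInt_minus (V := R_CompleteNormedModule)) by (apply ex_RInt_cont; auto).
  replace (d / 2) with (l * d / (2 * l)) by (field; lra).
  apply RInt_exp_bound; [lra| |].
  - intros t; apply (continuous_minus (V := R_NormedModule)); auto.
  - intros t; unfold minus, plus, opp; simpl.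
    eapply Rle_trans; [apply Hlip|].
    rewrite Rmult_assoc; apply Rmult_le_compat_l; [lra|auto].
Qed.

(** The first step integrates [f t y0], bounded by [b] and hence by [b * exp (2 * l * |t|)], which
    gives [b / (2 * l)]; each further step halves the bound by [picard_contraction]. *)
Lemma picard_step (f : R -> R -> R) (l b y0 : R) (n : nat) :
  0 < l -> preserves_continuity f ->
  (forall t a b, Rabs (f t a - f t b) <= l * Rabs (a - b)) ->
  (forall t, Rabs (f t y0) <= b) ->
  forall x, Rabs (picard f y0 (S n) x - picard f y0 n x)
            <= b / (2 * l) * (/ 2) ^ n * exp (2 * l * Rabs x).
Proof.
  intros Hl Hf Hlip Hb; induction n as [|n IH]; intros x.
  - simpl; rewrite Rplus_minus_l.
    rewrite Rmult_1_r; apply RInt_exp_bound; [lra| |].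
    + apply (Hf (fun _ => y0)); intros; apply continuous_const.
    + intros t; eapply Rle_trans; [apply Hb|].
      assert (0 <= b) by (eapply Rle_trans; [apply Rabs_pos|apply (Hb 0)]).
      rewrite <- (Rmult_1_r b) at 1; apply Rmult_le_compat_l; [lra|].
      rewrite <- exp_0; apply exp_nondecreasing.
      apply Rmult_le_pos; [lra|apply Rabs_pos].
  - change (picard f y0 (S (S n)) x)
      with (y0 + RInt (fun t => f t (picard f y0 (S n) t)) 0 x).
    change (picard f y0 (S n) x)
      with (y0 + RInt (fun t => f t (picard f y0 n t)) 0 x).
    rewrite Rminus_plus_l_l.
    replace (b / (2 * l) * (/ 2) ^ S n) with (b / (2 * l) * (/ 2) ^ n / 2)
      by (simpl; field; lra).
    apply picard_contraction; auto using continuous_picard.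
Qed.

(** The bounds of [picard_step] add up to a geometric sum. Keeping the factor [1 - (/ 2) ^ k] makes
    the induction on [k] close exactly. *)
Lemma picard_cauchy (f : R -> R -> R) (l b y0 : R) (n k : nat) (x : R) :
  0 < l -> preserves_continuity f ->
  (forall t a b, Rabs (f t a - f t b) <= l * Rabs (a - b)) ->
  (forall t, Rabs (f t y0) <= b) ->
  Rabs (picard f y0 (n + k) x - picard f y0 n x)
  <= b / l * (/ 2) ^ n * (1 - (/ 2) ^ k) * exp (2 * l * Rabs x).
Proof.
  intros Hl Hf Hlip Hb; induction k as [|k IH].
  - rewrite Nat.add_0_r, Rminus_diag, Rabs_R0; simpl; lra.
  - rewrite Nat.add_succ_r.
    pose proof (picard_step f l b y0 (n + k) Hl Hf Hlip Hb x) as Hs.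
    replace (_ - _) with ((picard f y0 (S (n + k)) x - picard f y0 (n + k) x)
      + (picard f y0 (n + k) x - picard f y0 n x)) by ring.
    eapply Rle_trans; [apply Rabs_triang|].
    eapply Rle_trans; [apply Rplus_le_compat; [exact Hs|exact IH]|].
    rewrite pow_add; apply Req_le; simpl; field; lra.
Qed.

Lemma half_pow_small (c e : R) : 0 < e -> exists n : nat, c * (/ 2) ^ n < e.
Proof.
  intros He.
  destruct (pow_lt_1_zero (/ 2)) with (y := e / (Rabs c + 1)) as [N HN].
  - rewrite Rabs_pos_eq; lra.
  - apply Rdiv_lt_0_compat; [exact He|pose proof (Rabs_pos c); lra].
  - exists N; specialize (HN N (Nat.le_refl N)).
    assert (Hp : 0 < (/ 2) ^ N) by (apply pow_lt; lra).
    rewrite Rabs_pos_eq in HN by lra.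
    apply Rlt_div_r in HN; [|pose proof (Rabs_pos c); lra].
    pose proof (Rle_abs c); nra.
Qed.

Lemma picard_converges (f : R -> R -> R) (l b y0 : R) :
  0 < l -> preserves_continuity f ->
  (forall t a b, Rabs (f t a - f t b) <= l * Rabs (a - b)) ->
  (forall t, Rabs (f t y0) <= b) ->
  forall x n, Rabs (real (Lim_seq (fun n => picard f y0 n x)) - picard f y0 n x)
              <= b / l * (/ 2) ^ n * exp (2 * l * Rabs x).
Proof.
  intros Hl Hf Hlip Hb x.
  set (e := exp (2 * l * Rabs x)).
  assert (He : 0 < e) by apply exp_pos.
  assert (Hbl : 0 <= b / l).
  { apply Rdiv_le_0_compat; [|exact Hl].
    eapply Rle_trans; [apply Rabs_pos|apply (Hb 0)]. }
  assert (Hpow : forall n, 0 < (/ 2) ^ n) by (intros; apply pow_lt; lra).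
  assert (Hnk : forall n m, (n <= m)%nat ->
    Rabs (picard f y0 m x - picard f y0 n x) <= b / l * (/ 2) ^ n * e).
  { intros n m Hnm; replace m with (n + (m - n))%nat by lia.
    eapply Rle_trans; [apply (picard_cauchy f l b); auto|]; fold e.
    apply Rmult_le_compat_r; [lra|].
    assert (0 <= b / l * (/ 2) ^ n) by (apply Rmult_le_pos; auto using Rlt_le).
    specialize (Hpow (m - n)%nat); nra. }
  (* [real] sends an infinite limit to 0, so finiteness of the limit has to come from the Cauchy
     criterion. The factor 2 accounts for comparing both terms with iterate [N]. *)
  assert (Hlim : is_lim_seq (fun n => picard f y0 n x)
                   (Finite (real (Lim_seq (fun n => picard f y0 n x))))).
  { apply Lim_seq_correct', ex_lim_seq_cauchy_corr; intros eps.
    destruct (half_pow_small (2 * (b / l * e)) eps (cond_pos eps)) as [N HN].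
    exists N; intros n m Hn Hm.
    replace (_ - _) with ((picard f y0 n x - picard f y0 N x)
      - (picard f y0 m x - picard f y0 N x)) by ring.
    eapply Rle_lt_trans; [apply Rabs_triang|]; rewrite Rabs_Ropp.
    pose proof (Hnk N n Hn); pose proof (Hnk N m Hm); lra. }
  intros n.
  (* The bound between two iterates passes to the limit in the later one. *)
  assert (H : is_lim_seq (fun m => Rabs (picard f y0 (m + n) x - picard f y0 n x))
     (Rabs (real (Lim_seq (fun n => picard f y0 n x)) - picard f y0 n x))).
  { apply (is_lim_seq_abs _ (Finite (_ - _))).
    apply is_lim_seq_minus'; [|apply is_lim_seq_const].
    now apply (is_lim_seq_incr_n (fun n => picard f y0 n x)). }
  refine (is_lim_seq_le _ _ _ (Finite _) _ H (is_lim_seq_const _)).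
  intros m; apply Hnk; lia.
Qed.

(** On [|z| <= |x| + 1] the weight is at most a constant, so convergence is uniform there and the
    usual three-epsilon argument applies. *)
Lemma locally_exp_uniform_limit_continuous (u : nat -> R -> R) (y : R -> R) (c k : R) :
  0 <= k -> 0 <= c -> (forall n x, continuous (u n) x) ->
  (forall x n, Rabs (y x - u n x) <= c * (/ 2) ^ n * exp (k * Rabs x)) ->
  forall x, continuous y x.
Proof.
  intros Hk Hc Hu Hy x; apply filterlim_locally; intros eps.
  set (e := exp (k * (Rabs x + 1))).
  destruct (half_pow_small (c * e) (eps / 3)) as [N HN].
  { pose proof (cond_pos eps); lra. }
  assert (Hb : forall z, Rabs z <= Rabs x + 1 -> Rabs (y z - u N z) < eps / 3).
  { intros z Hz; eapply Rle_lt_trans; [apply Hy|].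
    eapply Rle_lt_trans; [|exact HN].
    replace (c * e * (/ 2) ^ N) with (c * (/ 2) ^ N * e) by ring.
    apply Rmult_le_compat_l; [apply Rmult_le_pos; [lra|apply pow_le; lra]|].
    apply exp_nondecreasing, Rmult_le_compat_l; lra. }
  pose proof (proj1 (filterlim_locally _ _) (Hu N x)
    (mkposreal (eps / 3) ltac:(pose proof (cond_pos eps); lra))) as Hloc.
  assert (H1 : locally x (ball x 1)) by apply (locally_ball x (mkposreal 1 Rlt_0_1)).
  generalize (filter_and _ _ Hloc H1); apply filter_imp.
  intros z [Hz Hz1].
  change (Rabs (u N z - u N x) < eps / 3) in Hz.
  change (Rabs (z - x) < 1) in Hz1.
  change (Rabs (y z - y x) < eps).
  assert (Hz2 : Rabs z <= Rabs x + 1).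
  { replace z with ((z - x) + x) by ring.
    eapply Rle_trans; [apply Rabs_triang|]; lra. }
  pose proof (Hb z Hz2) as A1; pose proof (Hb x ltac:(lra)) as A2.
  apply Rabs_def2 in A1; apply Rabs_def2 in A2; apply Rabs_def2 in Hz.
  apply Rabs_def1; lra.
Qed.

(** The limit of the iterates solves the integral equation, which is then differentiated. The result
    is a sigma type so that a solution can be selected as a function of parameters. *)
Lemma picard_lindelof (f : R -> R -> R) (l b y0 : R) :
  0 < l -> preserves_continuity f ->
  (forall t a b, Rabs (f t a - f t b) <= l * Rabs (a - b)) ->
  (forall t, Rabs (f t y0) <= b) ->
  { y : R -> R | y 0 = y0 /\ forall x, is_derive y x (f x (y x)) }.
Proof.
  intros Hl Hf Hlip Hb.
  exists (fun x => real (Lim_seq (fun n => picard f y0 n x))).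
  pose proof (picard_converges f l b y0 Hl Hf Hlip Hb) as Hconv.
  set (y := fun x => real (Lim_seq (fun n => picard f y0 n x))) in *.
  assert (Hbl : 0 <= b / l).
  { apply Rdiv_le_0_compat; [|exact Hl].
    eapply Rle_trans; [apply Rabs_pos|apply (Hb 0)]. }
  assert (Hy : forall x, continuous y x).
  { apply (locally_exp_uniform_limit_continuous (picard f y0) y (b / l) (2 * l)); auto.
    - lra.
    - intros; now apply continuous_picard. }
  (* Both [y] and its image under the integral operator are within [b / l * (/ 2) ^ S n], times the
     weight, of iterate [S n]; hence they coincide. *)
  assert (Heq : forall x, y x = y0 + RInt (fun t => f t (y t)) 0 x).
  { intros x.
    apply Rminus_diag_uniq, Rabs_eq_0, Rle_antisym; [|apply Rabs_pos].
    apply le_epsilon; intros eps Heps.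
    destruct (half_pow_small (b / l * exp (2 * l * Rabs x)) eps Heps) as [n Hn].
    pose proof (Hconv x (S n)) as H1.
    pose proof (picard_contraction f l (b / l * (/ 2) ^ n) y (picard f y0 n) Hl Hf Hlip Hy
      (continuous_picard f y0 n Hf) (fun t => Hconv t n) x) as H2.
    replace (y x - _) with ((y x - picard f y0 (S n) x)
      - (RInt (fun t => f t (y t)) 0 x - RInt (fun t => f t (picard f y0 n t)) 0 x))
      by (simpl; ring).
    eapply Rle_trans; [apply Rabs_triang|]; rewrite Rabs_Ropp.
    simpl pow in H1; change (real (Lim_seq (fun n => picard f y0 n x))) with (y x) in H1; lra. }
  split.
  - change (y 0 = y0); rewrite Heq, (RInt_point (V := R_CompleteNormedModule)).
    apply Rplus_0_r.
  - intros x; change (is_derive y x (f x (y x))).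
    apply is_derive_ext with (fun x => y0 + RInt (fun t => f t (y t)) 0 x).
    { intros; symmetry; apply Heq. }
    replace (f x (y x)) with (0 + f x (y x)) by ring.
    apply (is_derive_plus (V := R_NormedModule)).
    + apply (is_derive_const (V := R_NormedModule)).
    + apply (is_derive_RInt_cont (fun t => f t (y t))); auto.
Qed.


(** * Gronwall's inequality and tools for continuity *)

Lemma ex_derive_continuity_pt (g : R -> R) (x : R) : ex_derive g x -> continuity_pt g x.
Proof.
  intros H; apply continuity_pt_filterlim.
  now apply (ex_derive_continuous (V := R_NormedModule)).
Qed.

(** The function [(g t + e / k) * exp (- k * t)] has nonpositive derivative on [[0, x]], so by the
    mean value theorem its value at [x] is at most its value at 0. *)
Lemma gronwall (g dg : R -> R) (k e x : R) :
  0 < k -> 0 <= x ->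
  (forall t, is_derive g t (dg t)) ->
  (forall t, 0 <= t <= x -> dg t <= k * g t + e) ->
  g x <= (g 0 + e / k) * exp (k * x) - e / k.
Proof.
  intros Hk Hx Hg Hle.
  destruct (MVT_gen (fun t => (g t + e / k) * exp (- k * t)) 0 x
    (fun t => (dg t - (k * g t + e)) * exp (- k * t))) as [c [Hc Heq]].
  - intros t _; pose proof (Hg t) as Ht.
    auto_derive; [now exists (dg t)|].
    rewrite (is_derive_unique (fun t : R => g t) _ _ Ht).
    field; lra.
  - intros t _; apply ex_derive_continuity_pt.
    auto_derive; now exists (dg t).
  - rewrite Rmin_left, Rmax_right in Hc by exact Hx.
    specialize (Hle c Hc).
    assert (He : exp (k * x) * exp (- k * x) = 1).
    { rewrite <- exp_plus; replace (k * x + - k * x) with 0 by ring; apply exp_0. }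
    assert (H : (g x + e / k) * exp (- k * x) <= g 0 + e / k).
    { rewrite (Rmult_0_r (- k)), exp_0 in Heq.
      assert (0 <= (k * g c + e - dg c) * exp (- k * c) * (x - 0)).
      { apply Rmult_le_pos; [|lra].
        apply Rmult_le_pos; [lra|apply Rlt_le, exp_pos]. }
      lra. }
    apply Rmult_le_compat_r with (r := exp (k * x)) in H; [|apply Rlt_le, exp_pos].
    rewrite Rmult_assoc, (Rmult_comm (exp (- k * x))), He in H; lra.
Qed.

(** Adapted to [gronwall], which is applied below to squared differences of solutions. The Lipschitz
    constant used is [Rabs c + 1], positive and with square at least [c], in place of a square
    root. *)
Lemma continuity_pt_of_sqr_bound (F : R -> R) (c x : R) :
  (forall y, Rabs (y - x) <= 1 -> (F y - F x) ^ 2 <= c * (y - x) ^ 2) ->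
  continuity_pt F x.
Proof.
  intros H.
  assert (Hc : 0 < Rabs c + 1) by (pose proof (Rabs_pos c); lra).
  apply continuity_pt_filterlim, filterlim_locally; intros eps.
  assert (Hd : 0 < Rmin 1 (eps / (Rabs c + 1))).
  { apply Rmin_glb_lt; [lra|apply Rdiv_lt_0_compat; [apply cond_pos|exact Hc]]. }
  exists (mkposreal _ Hd); intros y Hy.
  change (Rabs (y - x) < Rmin 1 (eps / (Rabs c + 1))) in Hy.
  change (Rabs (F y - F x) < eps).
  assert (H1 : Rabs (y - x) < 1) by (eapply Rlt_le_trans; [exact Hy|apply Rmin_l]).
  assert (H2 : Rabs (y - x) < eps / (Rabs c + 1))
    by (eapply Rlt_le_trans; [exact Hy|apply Rmin_r]).
  apply Rlt_div_r in H2; [|exact Hc].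
  specialize (H y (Rlt_le _ _ H1)).
  rewrite <- (pow2_abs (F y - F x)), <- (pow2_abs (y - x)) in H.
  pose proof (cond_pos eps); pose proof (Rabs_pos (y - x)); pose proof (Rabs_pos (F y - F x)).
  set (d := Rabs (y - x)) in *; set (D := Rabs (F y - F x)) in *.
  pose proof (Rle_abs c); pose proof (Rabs_pos c).
  set (k := d * (Rabs c + 1)) in *.
  assert (Hk : D ^ 2 <= k ^ 2) by (unfold k; nra).
  assert (0 <= k) by (apply Rmult_le_pos; lra).
  nra.
Qed.

(** The derivative of [sin t ^ 2] is [sin (2 * t)], bounded by 1. *)
Lemma sin_sqr_lipschitz (a b : R) : Rabs (sin a ^ 2 - sin b ^ 2) <= Rabs (a - b).
Proof.
  destruct (MVT_gen (fun t => sin t ^ 2) b a (fun t => 2 * sin t * cos t)) as [c [_ Heq]].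
  - intros t _; auto_derive; [exact I|ring].
  - intros t _; apply ex_derive_continuity_pt; auto_derive; exact I.
  - simpl in Heq |- *; rewrite Heq, Rabs_mult.
    rewrite <- (Rmult_1_l (Rabs (a - b))) at 2.
    apply Rmult_le_compat_r; [apply Rabs_pos|].
    rewrite <- sin_2a; apply Rabs_le, SIN_bound.
Qed.

(** * The Prüfer angle *)

(* [u'' = - w^2 q u], with [p = u' / w]. *)
Definition hill_system (q : R -> R) (w : R) (u p : R -> R) : Prop :=
  (forall x, is_derive u x (w * p x)) /\
  (forall x, is_derive p x (- w * q x * u x)).

Definition prufer_equation (q : R -> R) (w : R) (th : R -> R) : Prop :=
  forall x, is_derive th x (w * (1 + (q x - 1) * sin (th x) ^ 2)).

Lemma prufer_solution (q : R -> R) (m w th0 : R) :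
  (forall x, continuous q x) -> (forall x, 1 <= q x <= m) ->
  { th : R -> R | th 0 = th0 /\ prufer_equation q w th }.
Proof.
  intros Hq Hqm.
  assert (Hm : 1 <= m) by (specialize (Hqm 0); lra).
  pose proof (Rabs_pos w) as Hw.
  (* The Lipschitz constant in the angle is at most [Rabs w * m]; adding 1 keeps it positive when
     [w = 0]. *)
  apply (picard_lindelof (fun x a => w * (1 + (q x - 1) * sin a ^ 2))
           (Rabs w * m + 1) (Rabs w * m)).
  - nra.
  - intros g Hg t.
    apply (continuous_mult (fun _ => w)); [apply continuous_const|].
    apply (continuous_plus (V := R_NormedModule)); [apply continuous_const|].
    apply (continuous_mult (fun t => q t - 1)).
    + apply (continuous_minus (V := R_NormedModule)); [apply Hq|apply continuous_const].
    + apply (continuous_comp g (fun a => sin a ^ 2)); [apply Hg|].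
      apply (ex_derive_continuous (V := R_NormedModule)); auto_derive; exact I.
  - intros t a b.
    replace (_ - _) with (w * ((q t - 1) * (sin a ^ 2 - sin b ^ 2))) by ring.
    rewrite !Rabs_mult; specialize (Hqm t).
    rewrite (Rabs_pos_eq (q t - 1)) by lra.
    pose proof (sin_sqr_lipschitz a b); pose proof (Rabs_pos (a - b)).
    apply Rle_trans with (Rabs w * (m * Rabs (a - b))); [|nra].
    apply Rmult_le_compat_l; [exact Hw|].
    apply Rmult_le_compat; lra || apply Rabs_pos.
  - intros t; rewrite Rabs_mult; apply Rmult_le_compat_l; [exact Hw|].
    specialize (Hqm t); pose proof (SIN_bound th0) as Hs.
    assert (0 <= sin th0 ^ 2 <= 1) by nra.
    apply Rabs_le; nra.
Qed.

Lemma prufer_continuous (q : R -> R) (w : R) (th : R -> R) :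
  prufer_equation q w th -> forall x, continuous th x.
Proof. intros H x; eapply is_derive_continuous, H. Qed.

(** The amplitude [rho]: inserting polar coordinates into the Hill system gives
    [rho' = w (1 - q) sin th cos th rho], solved here with [rho(0) = 1]. The exponential form makes
    positivity immediate. *)
Definition prufer_radius (q : R -> R) (w : R) (th : R -> R) (x : R) : R :=
  exp (RInt (fun t => w * (1 - q t) * (sin (th t) * cos (th t))) 0 x).

Definition prufer_u (q : R -> R) (w : R) (th : R -> R) (x : R) : R :=
  prufer_radius q w th x * sin (th x).

Definition prufer_p (q : R -> R) (w : R) (th : R -> R) (x : R) : R :=
  prufer_radius q w th x * cos (th x).

Lemma prufer_radius_0 (q : R -> R) (w : R) (th : R -> R) : prufer_radius q w th 0 = 1.
Proof.
  unfold prufer_radius; rewrite (RInt_point (V := R_CompleteNormedModule)); apply exp_0.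
Qed.

Lemma prufer_radius_derive (q : R -> R) (w : R) (th : R -> R) (x : R) :
  (forall x, continuous q x) -> (forall x, continuous th x) ->
  is_derive (prufer_radius q w th) x
    (w * (1 - q x) * (sin (th x) * cos (th x)) * prufer_radius q w th x).
Proof.
  intros Hq Hth.
  apply (is_derive_comp exp _ x); [apply is_derive_exp|].
  apply (is_derive_RInt_cont (fun t => w * (1 - q t) * (sin (th t) * cos (th t)))).
  intros t; apply (continuous_mult (fun t => w * (1 - q t))).
  - apply (continuous_mult (fun _ => w)); [apply continuous_const|].
    apply (continuous_minus (V := R_NormedModule)); [apply continuous_const|apply Hq].
  - apply (continuous_comp th (fun a => sin a * cos a)); [apply Hth|].
    apply (ex_derive_continuous (V := R_NormedModule)); auto_derive; exact I.
Qed.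

Lemma prufer_hill_system (q : R -> R) (w : R) (th : R -> R) :
  (forall x, continuous q x) -> prufer_equation q w th ->
  hill_system q w (prufer_u q w th) (prufer_p q w th).
Proof.
  intros Hq Hth.
  assert (Hr : forall x, is_derive (prufer_radius q w th) x
     (w * (1 - q x) * (sin (th x) * cos (th x)) * prufer_radius q w th x)).
  { intros x; apply prufer_radius_derive; eauto using prufer_continuous. }
  split; intros x; unfold prufer_u, prufer_p;
    (auto_derive; [split; [eexists; apply Hr|split; [eexists; apply Hth|exact I]]|]);
    rewrite (is_derive_unique (fun x : R => prufer_radius q w th x) _ _ (Hr x)),
      (is_derive_unique (fun x : R => th x) _ _ (Hth x)).
  - ring.
  (* For [u] the terms in [q - 1] cancel outright; for [p] they combine into [cos^2 + sin^2]. *)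
  - transitivity (w * prufer_radius q w th x * sin (th x)
      * ((1 - q x) * (cos (th x) ^ 2 + sin (th x) ^ 2) - 1)); [ring|].
    pose proof (sin2_cos2 (th x)) as T; rewrite !Rsqr_pow2, Rplus_comm in T.
    rewrite T; ring.
Qed.


(** * Dependence on the speed, uniqueness and periodicity *)

(** Gronwall for the squared difference of two angles with the same start, the difference of speeds
    acting as the inhomogeneous term. *)
Lemma prufer_angle_continuous_speed (q : R -> R) (m : R) (th : R -> R -> R) :
  (forall x, 1 <= q x <= m) -> (forall w, prufer_equation q w (th w)) ->
  (forall w w', th w 0 = th w' 0) ->
  continuity (fun w => th w 1).
Proof.
  intros Hqm Hth H0 w0.
  assert (Hm : 1 <= m) by (specialize (Hqm 0); lra).
  pose proof (Rabs_pos w0) as Hw0.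
  (* The 1 comes from splitting the mixed term with [(w - w0)] by the arithmetic-geometric
     inequality, the rest from the Lipschitz bound on [sin^2]. *)
  set (k := 1 + 2 * Rabs w0 * m).
  assert (Hk : 0 < k) by (unfold k; nra).
  apply continuity_pt_of_sqr_bound with (m ^ 2 / k * exp (k * 1)); intros w _.
  set (F := fun v t => v * (1 + (q t - 1) * sin (th v t) ^ 2)).
  assert (Hd : forall t, is_derive (fun t => (th w t - th w0 t) ^ 2) t
             (2 * (th w t - th w0 t) * (F w t - F w0 t))).
  { intros t; pose proof (Hth w t) as A; pose proof (Hth w0 t) as B.
    auto_derive; [split; [now exists (F w t)|split; [now exists (F w0 t)|exact I]]|].
    rewrite (is_derive_unique (fun t : R => th w t) _ _ A),
      (is_derive_unique (fun t : R => th w0 t) _ _ B).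
    unfold F; ring. }
  pose proof (gronwall _ _ k (m ^ 2 * (w - w0) ^ 2) 1 Hk Rle_0_1 Hd) as G.
  cbv beta in G; rewrite (H0 w w0), Rminus_diag in G.
  assert (Hexp : 0 < exp (k * 1)) by apply exp_pos.
  assert (Hpos : 0 <= m ^ 2 * (w - w0) ^ 2 / k).
  { apply Rdiv_le_0_compat; [apply Rmult_le_pos; auto using pow2_ge_0|exact Hk]. }
  apply Rle_trans with ((0 ^ 2 + m ^ 2 * (w - w0) ^ 2 / k) * exp (k * 1)
                        - m ^ 2 * (w - w0) ^ 2 / k).
  2:{ replace (m ^ 2 / k * exp (k * 1) * (w - w0) ^ 2)
        with (m ^ 2 * (w - w0) ^ 2 / k * exp (k * 1)) by (field; lra).
      simpl (0 ^ 2); lra. }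
  apply G; intros t _; unfold F.
  set (a := th w t); set (b := th w0 t).
  pose proof (sin_sqr_lipschitz a b) as L; specialize (Hqm t).
  assert (Hs : 0 <= sin a ^ 2 <= 1) by (pose proof (SIN_bound a); nra).
  replace (_ - w0 * _) with ((w - w0) * (1 + (q t - 1) * sin a ^ 2)
    + w0 * (q t - 1) * (sin a ^ 2 - sin b ^ 2)) by ring.
  set (c := 1 + (q t - 1) * sin a ^ 2).
  assert (Hc : 0 <= c <= m) by (unfold c; nra).
  set (s := sin a ^ 2 - sin b ^ 2) in *.
  replace (2 * (a - b) * ((w - w0) * c + w0 * (q t - 1) * s))
    with (2 * (a - b) * ((w - w0) * c) + 2 * (w0 * ((q t - 1) * ((a - b) * s)))) by ring.
  assert (H1 : 2 * (a - b) * ((w - w0) * c) <= (a - b) ^ 2 + m ^ 2 * (w - w0) ^ 2).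
  { assert (c ^ 2 <= m ^ 2) by nra.
    assert (c ^ 2 * (w - w0) ^ 2 <= m ^ 2 * (w - w0) ^ 2)
      by (apply Rmult_le_compat_r; auto using pow2_ge_0).
    pose proof (pow2_ge_0 ((a - b) - (w - w0) * c)); nra. }
  assert (H2 : w0 * ((q t - 1) * ((a - b) * s)) <= Rabs w0 * (m * (a - b) ^ 2)).
  { eapply Rle_trans; [apply Rle_abs|]; rewrite !Rabs_mult.
    apply Rmult_le_compat_l; [exact Hw0|].
    rewrite (Rabs_pos_eq (q t - 1)) by lra.
    rewrite <- (pow2_abs (a - b)).
    pose proof (Rabs_pos (a - b)); pose proof (Rabs_pos s).
    apply Rmult_le_compat; [lra|nra|lra|nra]. }
  unfold k; lra.
Qed.

(** The difference of the solutions at speeds [w] and [w0] solves a Hill system forced by [w - w0]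
    times the solution at [w0]. That solution is bounded on [[0, 1]], so Gronwall applies to the
    squared norm of the difference. *)
Lemma hill_speed_bound (q : R -> R) (m w0 : R) (u p : R -> R -> R) :
  (forall x, 1 <= q x <= m) -> (forall w, hill_system q w (u w) (p w)) ->
  (forall w w', u w 0 = u w' 0) -> (forall w w', p w 0 = p w' 0) ->
  exists c, forall w, Rabs (w - w0) <= 1 ->
    (u w 1 - u w0 1) ^ 2 + (p w 1 - p w0 1) ^ 2 <= c * (w - w0) ^ 2.
Proof.
  intros Hqm Hup Hu0 Hp0.
  assert (Hm : 1 <= m) by (specialize (Hqm 0); lra).
  pose proof (Rabs_pos w0) as Hw0.
  destruct (continuity_ab_maj (fun t => p w0 t ^ 2 + m ^ 2 * u w0 t ^ 2) 0 1 Rle_0_1)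
    as [tb [Hb _]].
  { intros t _; destruct (Hup w0) as [Hu Hp].
    apply ex_derive_continuity_pt; auto_derive.
    split; [eexists; apply Hp|split; [eexists; apply Hu|exact I]]. }
  set (B := p w0 tb ^ 2 + m ^ 2 * u w0 tb ^ 2) in Hb.
  assert (HB : 0 <= B) by (unfold B; nra).
  (* The condition [Rabs (w - w0) <= 1] gives [Rabs w <= Rabs w0 + 1], so the growth rate is uniform
     in [w]; the final 1 absorbs the squares split off from the forcing terms. *)
  set (k := (Rabs w0 + 1) * m + 1).
  assert (Hk : 0 < k) by (unfold k; nra).
  exists (B / k * exp (k * 1)); intros w Hw.
  assert (Hd : forall t, is_derive (fun t => (u w t - u w0 t) ^ 2 + (p w t - p w0 t) ^ 2) t
     (2 * (u w t - u w0 t) * (w * p w t - w0 * p w0 t)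
      + 2 * (p w t - p w0 t) * (- w * q t * u w t - - w0 * q t * u w0 t))).
  { intros t; destruct (Hup w) as [Hu Hp], (Hup w0) as [Hu' Hp'].
    auto_derive.
    { repeat split; [eexists; apply Hu|eexists; apply Hu'|eexists; apply Hp|eexists; apply Hp']. }
    rewrite (is_derive_unique (fun t : R => u w t) _ _ (Hu t)),
      (is_derive_unique (fun t : R => u w0 t) _ _ (Hu' t)),
      (is_derive_unique (fun t : R => p w t) _ _ (Hp t)),
      (is_derive_unique (fun t : R => p w0 t) _ _ (Hp' t)); ring. }
  pose proof (gronwall _ _ k (B * (w - w0) ^ 2) 1 Hk Rle_0_1 Hd) as G.
  cbv beta in G; rewrite (Hu0 w w0), (Hp0 w w0), !Rminus_diag in G.
  assert (Hexp : 0 < exp (k * 1)) by apply exp_pos.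
  assert (Hpos : 0 <= B * (w - w0) ^ 2 / k).
  { apply Rdiv_le_0_compat; [apply Rmult_le_pos; auto using pow2_ge_0|exact Hk]. }
  apply Rle_trans with ((0 ^ 2 + 0 ^ 2 + B * (w - w0) ^ 2 / k) * exp (k * 1)
                        - B * (w - w0) ^ 2 / k).
  2:{ replace (B / k * exp (k * 1) * (w - w0) ^ 2)
        with (B * (w - w0) ^ 2 / k * exp (k * 1)) by (field; lra).
      simpl (0 ^ 2); lra. }
  apply G; intros t Ht; specialize (Hb t Ht); specialize (Hqm t).
  assert (Hww : Rabs w <= Rabs w0 + 1).
  { replace w with (w0 + (w - w0)) by ring.
    eapply Rle_trans; [apply Rabs_triang|]; lra. }
  set (d := u w t - u w0 t); set (e := p w t - p w0 t).
  set (u0 := u w0 t) in *; set (p0 := p w0 t) in *.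
  replace (u w t) with (u0 + d) by (unfold d; ring).
  replace (p w t) with (p0 + e) by (unfold e; ring).
  replace (2 * d * _ + _) with (w * (1 - q t) * (2 * d * e)
    + (2 * d * ((w - w0) * p0) - 2 * e * (q t * (w - w0) * u0))) by ring.
  assert (H1 : w * (1 - q t) * (2 * d * e) <= (Rabs w0 + 1) * m * (d ^ 2 + e ^ 2)).
  { eapply Rle_trans; [apply Rle_abs|]; rewrite Rabs_mult.
    pose proof (Rabs_pos w).
    apply Rmult_le_compat; try apply Rabs_pos.
    - rewrite Rabs_mult; apply Rmult_le_compat; try apply Rabs_pos; [exact Hww|].
      apply Rabs_le; lra.
    - apply Rabs_le; pose proof (pow2_ge_0 (d - e)); pose proof (pow2_ge_0 (d + e)); lra. }
  assert (H2 : 2 * d * ((w - w0) * p0) - 2 * e * (q t * (w - w0) * u0)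
               <= d ^ 2 + e ^ 2 + B * (w - w0) ^ 2).
  { pose proof (pow2_ge_0 (d - (w - w0) * p0)); pose proof (pow2_ge_0 (e + q t * (w - w0) * u0)).
    assert (q t ^ 2 * u0 ^ 2 <= m ^ 2 * u0 ^ 2).
    { apply Rmult_le_compat_r; [apply pow2_ge_0|nra]. }
    assert ((p0 ^ 2 + q t ^ 2 * u0 ^ 2) * (w - w0) ^ 2 <= B * (w - w0) ^ 2).
    { apply Rmult_le_compat_r; [apply pow2_ge_0|lra]. }
    lra. }
  unfold k; lra.
Qed.

(** The coefficient matrix has trace 0, so the Wronskian has zero derivative. This yields
    determinant 1 for the monodromy matrix. *)
Lemma hill_wronskian (q : R -> R) (w : R) (u1 p1 u2 p2 : R -> R) :
  hill_system q w u1 p1 -> hill_system q w u2 p2 ->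
  u1 1 * p2 1 - u2 1 * p1 1 = u1 0 * p2 0 - u2 0 * p1 0.
Proof.
  intros [Hu1 Hp1] [Hu2 Hp2]; symmetry.
  apply (eq_is_derive (V := R_NormedModule) (fun t => u1 t * p2 t - u2 t * p1 t) 0 1);
    [|lra].
  intros t _; unfold zero; simpl; auto_derive.
  { repeat split; eexists; eauto. }
  rewrite (is_derive_unique (fun t : R => u1 t) _ _ (Hu1 t)),
    (is_derive_unique (fun t : R => u2 t) _ _ (Hu2 t)),
    (is_derive_unique (fun t : R => p1 t) _ _ (Hp1 t)),
    (is_derive_unique (fun t : R => p2 t) _ _ (Hp2 t)); ring.
Qed.

Lemma hill_linear (q : R -> R) (w a b : R) (u1 p1 u2 p2 : R -> R) :
  hill_system q w u1 p1 -> hill_system q w u2 p2 ->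
  hill_system q w (fun x => a * u1 x + b * u2 x) (fun x => a * p1 x + b * p2 x).
Proof.
  intros [Hu1 Hp1] [Hu2 Hp2]; split; intros t; auto_derive;
    try (repeat split; eexists; eauto).
  - rewrite (is_derive_unique (fun t : R => u1 t) _ _ (Hu1 t)),
      (is_derive_unique (fun t : R => u2 t) _ _ (Hu2 t)); ring.
  - rewrite (is_derive_unique (fun t : R => p1 t) _ _ (Hp1 t)),
      (is_derive_unique (fun t : R => p2 t) _ _ (Hp2 t)); ring.
Qed.

(** Gronwall with [e = 0] for [u^2 + p^2], which starts at 0. It runs forward only; negative [x] is
    reached by reflection. *)
Lemma hill_unique_right (q : R -> R) (m w : R) (u p : R -> R) :
  (forall x, 1 <= q x <= m) -> hill_system q w u p ->
  u 0 = 0 -> p 0 = 0 -> forall x, 0 <= x -> u x = 0 /\ p x = 0.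
Proof.
  intros Hqm [Hu Hp] Hu0 Hp0 x Hx.
  assert (Hm : 1 <= m) by (specialize (Hqm 0); lra).
  pose proof (Rabs_pos w) as Hw.
  assert (Hk : 0 < Rabs w * m + 1) by nra.
  assert (Hd : forall t, is_derive (fun t => u t ^ 2 + p t ^ 2) t
     (w * (1 - q t) * (2 * u t * p t))).
  { intros t; auto_derive; [repeat split; eexists; eauto|].
    rewrite (is_derive_unique (fun t : R => u t) _ _ (Hu t)),
      (is_derive_unique (fun t : R => p t) _ _ (Hp t)); ring. }
  assert (G : u x ^ 2 + p x ^ 2 <= 0).
  { eapply Rle_trans; [apply (gronwall _ _ _ 0 x Hk Hx Hd)|].
    - intros t _; specialize (Hqm t).
      apply Rle_trans with (Rabs w * m * (u t ^ 2 + p t ^ 2)).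
      + eapply Rle_trans; [apply Rle_abs|]; rewrite Rabs_mult.
        apply Rmult_le_compat; try apply Rabs_pos.
        * rewrite Rabs_mult; apply Rmult_le_compat_l; [exact Hw|apply Rabs_le; lra].
        * apply Rabs_le; pose proof (pow2_ge_0 (u t - p t));
            pose proof (pow2_ge_0 (u t + p t)); lra.
      + pose proof (pow2_ge_0 (u t)); pose proof (pow2_ge_0 (p t)); lra.
    - rewrite Hu0, Hp0; apply Req_le; field; lra. }
  split; nra.
Qed.

(** Reflection reverses the sign of [u'], hence the sign on [p]. *)
Lemma hill_reflect (q : R -> R) (w : R) (u p : R -> R) :
  hill_system q w u p ->
  hill_system (fun x => q (- x)) w (fun x => u (- x)) (fun x => - p (- x)).
Proof.
  intros [Hu Hp]; split; intros t; auto_derive; try (eexists; eauto).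
  - rewrite (is_derive_unique (fun t : R => u t) _ _ (Hu (- t))); ring.
  - rewrite (is_derive_unique (fun t : R => p t) _ _ (Hp (- t))); ring.
Qed.

Lemma hill_unique (q : R -> R) (m w : R) (u p : R -> R) :
  (forall x, 1 <= q x <= m) -> hill_system q w u p ->
  u 0 = 0 -> p 0 = 0 -> forall x, u x = 0.
Proof.
  intros Hqm Hup Hu0 Hp0 x.
  destruct (Rle_dec 0 x) as [Hx|Hx].
  - now apply (hill_unique_right q m w u p).
  - rewrite <- (Ropp_involutive x).
    apply (hill_unique_right (fun x => q (- x)) m w
      (fun x => u (- x)) (fun x => - p (- x))); auto using hill_reflect; try lra.
    + now rewrite Ropp_0.
    + rewrite Ropp_0, Hp0; ring.
Qed.

Lemma hill_shift (q : R -> R) (w : R) (u p : R -> R) :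
  (forall x, q (x + 1) = q x) -> hill_system q w u p ->
  hill_system q w (fun x => u (x + 1)) (fun x => p (x + 1)).
Proof.
  intros Hq [Hu Hp]; split; intros t; auto_derive; try (eexists; eauto).
  - rewrite (is_derive_unique (fun t : R => u t) _ _ (Hu (t + 1))); ring.
  - rewrite (is_derive_unique (fun t : R => p t) _ _ (Hp (t + 1))), Hq; ring.
Qed.

(** The solution shifted by one period minus the solution itself solves the same system with zero
    data at 0, so it vanishes. *)
Lemma hill_periodic (q : R -> R) (m w : R) (u p : R -> R) :
  (forall x, 1 <= q x <= m) -> (forall x, q (x + 1) = q x) -> hill_system q w u p ->
  u 1 = u 0 -> p 1 = p 0 -> forall x, u (x + 1) = u x.
Proof.
  intros Hqm Hq Hup Hu Hp x.
  pose proof (hill_linear q w 1 (-1) _ _ _ _ (hill_shift q w u p Hq Hup) Hup) as H.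
  pose proof (hill_unique q m w _ _ Hqm H) as U; cbv beta in U.
  rewrite Rplus_0_l in U.
  specialize (U ltac:(lra) ltac:(lra) x); lra.
Qed.


(** * A speed with a periodic solution *)

Lemma prufer_angle_range (q : R -> R) (m w : R) (th : R -> R) :
  (forall x, 1 <= q x <= m) -> 0 <= w -> prufer_equation q w th ->
  w <= th 1 - th 0 <= w * m.
Proof.
  intros Hqm Hw Hth.
  destruct (MVT_gen th 0 1 (fun x => w * (1 + (q x - 1) * sin (th x) ^ 2)))
    as [c [_ Heq]].
  - intros x _; apply Hth.
  - intros x _; apply ex_derive_continuity_pt; eexists; apply Hth.
  - rewrite Heq; specialize (Hqm c).
    assert (0 <= sin (th c) ^ 2 <= 1) by (pose proof (SIN_bound (th c)); nra).
    assert (1 <= 1 + (q c - 1) * sin (th c) ^ 2 <= m) by nra.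
    nra.
Qed.

(** For the matrix [A] with rows [(a, b)] and [(c, d)], [det (A - 1) = det A - tr A + 1 = 0]. The
    vector [(b, 1 - a)] is killed by the first row of [A - 1], hence by the second; if [b = 0], then
    [(d - 1)^2 = 0] and [(0, 1)] is fixed. *)
Lemma unipotent_fixed_vector (a b c d : R) :
  a * d - b * c = 1 -> a + d = 2 ->
  exists x y, a * x + b * y = x /\ c * x + d * y = y /\ (x <> 0 \/ y <> 0).
Proof.
  intros Hdet Htr.
  destruct (Req_dec b 0) as [Hb|Hb].
  - exists 0, 1; subst b; assert (d = 1) by nra.
    repeat split; [ring|lra|right; lra].
  - exists b, (1 - a); repeat split; [ring| |now left].
    replace d with (2 - a) in * by lra; lra.
Qed.

Lemma hill_periodic_data (q : R -> R) (m : R) :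
  (forall x, continuous q x) -> (forall x, 1 <= q x <= m) ->
  exists w u p, 0 < w /\ hill_system q w u p /\
    u 1 = u 0 /\ p 1 = p 0 /\ (u 0 <> 0 \/ p 0 <> 0).
Proof.
  intros Hq Hqm.
  assert (Hm : 1 <= m) by (specialize (Hqm 0); lra).
  (* The angles 0 and [PI / 2] correspond to the initial data [(u, p) = (0, 1)] and [(1, 0)], so the
     two solutions form a fundamental system. *)
  set (th1 := fun w => proj1_sig (prufer_solution q m w 0 Hq Hqm)).
  set (th2 := fun w => proj1_sig (prufer_solution q m w (PI / 2) Hq Hqm)).
  assert (Hth1 : forall w, th1 w 0 = 0 /\ prufer_equation q w (th1 w))
    by (intros w; exact (proj2_sig (prufer_solution q m w 0 Hq Hqm))).
  assert (Hth2 : forall w, th2 w 0 = PI / 2 /\ prufer_equation q w (th2 w))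
    by (intros w; exact (proj2_sig (prufer_solution q m w (PI / 2) Hq Hqm))).
  set (u1 := fun w => prufer_u q w (th1 w)); set (p1 := fun w => prufer_p q w (th1 w)).
  set (u2 := fun w => prufer_u q w (th2 w)); set (p2 := fun w => prufer_p q w (th2 w)).
  assert (H1 : forall w, hill_system q w (u1 w) (p1 w))
    by (intros w; apply prufer_hill_system; [exact Hq|apply Hth1]).
  assert (H2 : forall w, hill_system q w (u2 w) (p2 w))
    by (intros w; apply prufer_hill_system; [exact Hq|apply Hth2]).
  assert (Hu1 : forall w, u1 w 0 = 0).
  { intros w; unfold u1, prufer_u; rewrite (proj1 (Hth1 w)), sin_0; ring. }
  assert (Hp1 : forall w, p1 w 0 = 1).
  { intros w; unfold p1, prufer_p; rewrite (proj1 (Hth1 w)), prufer_radius_0, cos_0; ring. }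
  assert (Hu2 : forall w, u2 w 0 = 1).
  { intros w; unfold u2, prufer_u; rewrite (proj1 (Hth2 w)), prufer_radius_0, sin_PI2; ring. }
  assert (Hp2 : forall w, p2 w 0 = 0).
  { intros w; unfold p2, prufer_p; rewrite (proj1 (Hth2 w)), cos_PI2; ring. }
  (* In the coordinates [(u, p)] the monodromy matrix has columns [(u2, p2)] and [(u1, p1)] taken at
     1. *)
  assert (Hdet : forall w, u2 w 1 * p1 w 1 - u1 w 1 * p2 w 1 = 1).
  { intros w; rewrite (hill_wronskian q w _ _ _ _ (H2 w) (H1 w)), Hu1, Hp1, Hu2, Hp2; ring. }
  assert (Htr : continuity (fun w => p1 w 1 + u2 w 1)).
  { intros w.
    destruct (hill_speed_bound q m w u1 p1 Hqm H1) as [c1 Hc1];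
      [intros; rewrite !Hu1; reflexivity|intros; rewrite !Hp1; reflexivity|].
    destruct (hill_speed_bound q m w u2 p2 Hqm H2) as [c2 Hc2];
      [intros; rewrite !Hu2; reflexivity|intros; rewrite !Hp2; reflexivity|].
    apply continuity_pt_plus.
    - apply continuity_pt_of_sqr_bound with c1; intros v Hv; specialize (Hc1 v Hv).
      pose proof (pow2_ge_0 (u1 v 1 - u1 w 1)); lra.
    - apply continuity_pt_of_sqr_bound with c2; intros v Hv; specialize (Hc2 v Hv).
      pose proof (pow2_ge_0 (p2 v 1 - p2 w 1)); lra. }
  assert (Hang : continuity (fun w => th1 w 1)).
  { apply (prufer_angle_continuous_speed q m); [exact Hqm|apply Hth1|].
    intros w w'; now rewrite (proj1 (Hth1 w)), (proj1 (Hth1 w')). }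
  pose proof PI_RGT_0 as HPI.
  assert (HPIm : 0 < PI / m) by (apply Rdiv_lt_0_compat; lra).
  (* The bounds on the advance of the angle give at most [PI] at speed [PI / m] and at least
     [2 * PI] at speed [2 * PI]. *)
  assert (Hangle : forall y, PI <= y <= 2 * PI -> exists w, 0 < w /\ th1 w 1 = y).
  { intros y Hy.
    assert (A1 : th1 (PI / m) 1 <= PI).
    { destruct (prufer_angle_range q m (PI / m) (th1 (PI / m)) Hqm) as [_ A];
        [lra|apply Hth1|].
      rewrite (proj1 (Hth1 _)) in A.
      replace (PI / m * m) with PI in A by (field; lra); lra. }
    assert (A2 : 2 * PI <= th1 (2 * PI) 1).
    { destruct (prufer_angle_range q m (2 * PI) (th1 (2 * PI)) Hqm) as [A _];
        [lra|apply Hth1|].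
      rewrite (proj1 (Hth1 _)) in A; lra. }
    destruct (IVT_gen (fun w => th1 w 1) (PI / m) (2 * PI) y Hang) as [w [[Hw _] Hwy]].
    - rewrite Rmin_left, Rmax_right by lra; lra.
    - exists w; split; [|exact Hwy].
      eapply Rlt_le_trans; [|exact Hw]; apply Rmin_glb_lt; lra. }
  destruct (Hangle PI) as [wa [Hwa Ha]]; [lra|].
  destruct (Hangle (2 * PI)) as [wb [Hwb Hb]]; [lra|].
  (* Since [u1] vanishes at 1, the matrix is triangular and its diagonal entries have product 1.
     Here both are negative; at [wb] both are positive with sum at least 2. *)
  assert (Ta : p1 wa 1 + u2 wa 1 <= 2).
  { pose proof (Hdet wa) as D.
    assert (E1 : u1 wa 1 = 0) by (unfold u1, prufer_u; rewrite Ha, sin_PI; ring).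
    assert (E2 : p1 wa 1 < 0).
    { unfold p1, prufer_p; rewrite Ha, cos_PI.
      assert (0 < prufer_radius q wa (th1 wa) 1) by apply exp_pos; lra. }
    rewrite E1 in D; nra. }
  assert (Tb : 2 <= p1 wb 1 + u2 wb 1).
  { pose proof (Hdet wb) as D.
    assert (E1 : u1 wb 1 = 0) by (unfold u1, prufer_u; rewrite Hb, sin_2PI; ring).
    assert (E2 : 0 < p1 wb 1).
    { unfold p1, prufer_p; rewrite Hb, cos_2PI, Rmult_1_r; apply exp_pos. }
    rewrite E1 in D; pose proof (pow2_ge_0 (p1 wb 1 - u2 wb 1)); nra. }
  (* The order of [wa] and [wb] is unknown, so the speed found is only known to be at least their
     minimum, which is positive. *)
  destruct (IVT_gen (fun w => p1 w 1 + u2 w 1) wa wb 2 Htr) as [w [[Hw _] Htw]].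
  { rewrite Rmin_left, Rmax_right by lra; lra. }
  cbv beta in Htw.
  destruct (unipotent_fixed_vector (u2 w 1) (u1 w 1) (p2 w 1) (p1 w 1))
    as [x [y [Hx [Hy Hxy]]]]; [apply Hdet|lra|].
  (* This solution has initial data [(x, y)], the fixed vector, and so returns to them at 1. *)
  exists w, (fun t => x * u2 w t + y * u1 w t), (fun t => x * p2 w t + y * p1 w t).
  rewrite Hu1, Hp1, Hu2, Hp2.
  split; [eapply Rlt_le_trans; [|exact Hw]; now apply Rmin_glb_lt|].
  split; [now apply hill_linear|].
  split; [lra|split; [lra|]].
  destruct Hxy; [left|right]; lra.
Qed.

(** If [u] vanished identically, then [w * p 0 = u'(0) = 0], so both initial values would be 0. *)
Lemma hill_nonzero (q : R -> R) (w : R) (u p : R -> R) :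
  0 < w -> hill_system q w u p -> u 0 <> 0 \/ p 0 <> 0 -> exists x, u x <> 0.
Proof.
  intros Hw [Hu _] [H|H]; [now exists 0|].
  apply not_all_not_ex; intros Hall.
  assert (Hz : forall x, u x = 0) by (intros x; apply NNPP, Hall).
  apply H, (Rmult_eq_reg_l w); [|lra].
  rewrite Rmult_0_r, <- (is_derive_unique _ _ _ (Hu 0)), (Derive_ext _ _ _ Hz).
  apply Derive_const.
Qed.

(** * Reduction of the Hamiltonian to Hill's equation *)

Lemma is_derive_RtoC (g : R -> R) (x l : R) :
  is_derive g x l ->
  @is_derive R_AbsRing C_R_NormedModule (fun t => RtoC (g t)) x (RtoC l).
Proof.
  intros H.
  pose proof (is_derive_scal_l (V := C_R_NormedModule) g x l (RtoC 1) H) as D.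
  replace (RtoC l) with (@scal R_AbsRing C_R_NormedModule l (RtoC 1)).
  - eapply is_derive_ext; [|exact D]; intros t; simpl.
    unfold RtoC, scal; simpl; unfold prod_scal, scal; simpl; unfold mult; simpl.
    f_equal; ring.
  - unfold RtoC, scal; simpl; unfold prod_scal, scal; simpl; unfold mult; simpl.
    f_equal; ring.
Qed.

Lemma C_derive_R_RtoC (g dg : R -> R) :
  (forall x, is_derive g x (dg x)) ->
  forall x, C_derive_R (fun t => RtoC (g t)) x = RtoC (dg x).
Proof.
  intros H x; unfold C_derive_R, RtoC; simpl; f_equal.
  - now apply is_derive_unique.
  - apply Derive_const.
Qed.

Lemma real_energy_eigenstate (r E : R) (V u du ddu : R -> R) :
  0 < r -> (forall x, is_derive u x (du x)) -> (forall x, is_derive du x (ddu x)) ->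
  (forall x, ddu x = - r ^ 2 * (E - V x) * u x) ->
  (forall x, u (x + 1) = u x) -> (exists x, u x <> 0) ->
  energy_eigenstate r V E (fun x => RtoC (u x)).
Proof.
  intros Hr Hu Hdu Heq Hper [x0 Hx0].
  assert (D1 : forall x, C_derive_R (fun t => RtoC (u t)) x = RtoC (du x))
    by now apply C_derive_R_RtoC.
  assert (D2 : forall x, C_derive_R (C_derive_R (fun t => RtoC (u t))) x = RtoC (ddu x)).
  { intros x; rewrite <- (C_derive_R_RtoC du ddu Hdu).
    unfold C_derive_R at 1 3; f_equal; apply Derive_ext; intros t; now rewrite D1. }
  split; [split; [|split]|split].
  - intros x; now rewrite Hper.
  - intros x; exists (RtoC (du x)); now apply is_derive_RtoC.
  - intros x; exists (RtoC (ddu x)).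
    eapply is_derive_ext; [intros t; symmetry; apply D1|now apply is_derive_RtoC].
  - exists x0; intros H; apply Hx0; now apply RtoC_inj.
  - intros x; unfold hamiltonian; rewrite D2, Heq.
    rewrite <- !RtoC_mult, <- RtoC_opp, <- RtoC_plus; f_equal; field; lra.
Qed.

(** * Radially invariant potentials on circles *)

(** [acos] covers the upper half circle; on the lower half the angle is [2 * PI - acos a]. Keeping
    [phi] in [[0, 1]] lets extrema be sought on a compact interval. *)
Lemma circle_angle (a b : R) :
  a ^ 2 + b ^ 2 = 1 ->
  exists phi, 0 <= phi <= 1 /\ cos (2 * PI * phi) = a /\ sin (2 * PI * phi) = b.
Proof.
  intros H.
  pose proof PI_RGT_0 as HPI.
  assert (Ha : -1 <= a <= 1) by nra.
  pose proof (acos_bound a) as Hb.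
  assert (Hs : sin (acos a) = Rabs b).
  { rewrite sin_acos by exact Ha.
    replace (1 - Rsqr a) with (Rsqr b) by (unfold Rsqr; lra).
    apply sqrt_Rsqr_abs. }
  destruct (Rle_dec 0 b) as [H0|H0].
  - exists (acos a / (2 * PI)).
    replace (2 * PI * (acos a / (2 * PI))) with (acos a) by (field; lra).
    split; [split|].
    + apply Rdiv_le_0_compat; lra.
    + apply Rle_div_l; lra.
    + rewrite cos_acos, Hs, Rabs_pos_eq by assumption; auto.
  - exists (1 - acos a / (2 * PI)).
    replace (2 * PI * (1 - acos a / (2 * PI))) with (- acos a + 2 * PI) by (field; lra).
    assert (0 <= acos a / (2 * PI)) by (apply Rdiv_le_0_compat; lra).
    assert (acos a / (2 * PI) <= 1) by (apply Rle_div_l; lra).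
    split; [lra|].
    rewrite cos_plus, sin_plus, cos_2PI, sin_2PI, cos_neg, sin_neg.
    rewrite cos_acos, Hs, Rabs_left by lra; split; ring.
Qed.

(** All circles carry the same potential, so the radius can be chosen after the Hill equation has
    been solved. *)
Lemma circle_restriction_radial (f : R -> R -> R) (r phi : R) :
  radially_invariant f -> 0 < r ->
  circle_restriction r f phi = circle_restriction 1 f phi.
Proof.
  intros Hf Hr; unfold circle_restriction; rewrite !Rmult_1_l.
  apply Hf; [exact Hr|]; intros H; injection H; intros Hs Hc.
  pose proof (sin2_cos2 (2 * PI * phi)) as T.
  rewrite Hs, Hc in T; unfold Rsqr in T; lra.
Qed.

Lemma unit_circle_punctured (phi : R) :
  punctured_plane (1 * cos (2 * PI * phi)) (1 * sin (2 * PI * phi)).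
Proof.
  intros H; injection H; rewrite !Rmult_1_l; intros Hs Hc.
  pose proof (sin2_cos2 (2 * PI * phi)) as T.
  rewrite Hs, Hc in T; unfold Rsqr in T; lra.
Qed.

Lemma radial_value_on_circle (f : R -> R -> R) (x y : R) :
  radially_invariant f -> punctured_plane x y ->
  exists phi, 0 <= phi <= 1 /\ f x y = circle_restriction 1 f phi.
Proof.
  intros Hf Hxy.
  assert (Hpos : 0 < x ^ 2 + y ^ 2).
  { destruct (Req_dec x 0) as [Hx|Hx]; [|nra].
    destruct (Req_dec y 0) as [Hy|Hy]; [|nra].
    exfalso; apply Hxy; now subst. }
  set (s := sqrt (x ^ 2 + y ^ 2)).
  assert (Hs : 0 < s) by now apply sqrt_lt_R0.
  assert (Hs2 : s ^ 2 = x ^ 2 + y ^ 2) by (apply pow2_sqrt; lra).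
  destruct (circle_angle (x / s) (y / s)) as [phi [Hphi [Hc Hsn]]].
  { replace ((x / s) ^ 2 + (y / s) ^ 2) with ((x ^ 2 + y ^ 2) / s ^ 2) by (field; lra).
    rewrite Hs2; field; lra. }
  exists phi; split; [exact Hphi|].
  rewrite <- (circle_restriction_radial f s) by assumption.
  unfold circle_restriction; rewrite Hc, Hsn; f_equal; field; lra.
Qed.

Lemma circle_restriction_continuous (f : R -> R -> R) (phi : R) :
  smooth_on punctured_plane f -> continuous (circle_restriction 1 f) phi.
Proof.
  intros Hf; unfold circle_restriction.
  apply (continuous_comp_2 (fun t => 1 * cos (2 * PI * t)) (fun t => 1 * sin (2 * PI * t)) f).
  - apply (ex_derive_continuous (V := R_NormedModule)); auto_derive; exact I.
  - apply (ex_derive_continuous (V := R_NormedModule)); auto_derive; exact I.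
  (* Smoothness at order 0 supplies continuity in both variables. *)
  - apply continuity_2d_pt_filterlim.
    apply (Hf 0%nat _ _ (unit_circle_punctured phi)).
Qed.

Lemma circle_restriction_periodic (f : R -> R -> R) (r phi : R) :
  circle_restriction r f (phi + 1) = circle_restriction r f phi.
Proof.
  unfold circle_restriction.
  replace (2 * PI * (phi + 1)) with (2 * PI * phi + 2 * PI) by ring.
  rewrite cos_plus, sin_plus, cos_2PI, sin_2PI; f_equal; ring.
Qed.

Theorem theorem1p1 (Vt : R -> R -> R)
  (Vt_smooth : smooth_on punctured_plane Vt)
  (Vt_radial : radially_invariant Vt) :
  exists maxV : R, is_max_on punctured_plane Vt maxV /\
    forall E : R, maxV < E ->
      exists r : R, 0 < r /\
        exists psi : R -> C, energy_eigenstate r (circle_restriction r Vt) E psi.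
Proof.
  set (V := circle_restriction 1 Vt).
  assert (Vc : forall x, continuous V x)
    by (intros x; now apply circle_restriction_continuous).
  assert (Vc' : forall x, 0 <= x <= 1 -> continuity_pt V x)
    by (intros x _; apply continuity_pt_filterlim, Vc).
  destruct (continuity_ab_maj V 0 1 Rle_0_1 Vc') as [xM [HM _]].
  destruct (continuity_ab_min V 0 1 Rle_0_1 Vc') as [xm [Hm _]].
  assert (Hbnd : forall x y, punctured_plane x y -> V xm <= Vt x y <= V xM).
  { intros x y Hxy.
    destruct (radial_value_on_circle Vt x y Vt_radial Hxy) as [phi [Hphi ->]].
    split; [now apply Hm|now apply HM]. }
  exists (V xM); split.
  - split; [|intros x y Hxy; now apply Hbnd].
    exists (1 * cos (2 * PI * xM)), (1 * sin (2 * PI * xM)).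
    split; [apply unit_circle_punctured|reflexivity].
  - intros E HE.
    (* Dividing by [E - V xM], positive by assumption on [E], normalizes the coefficient to be at
       least 1; the minimum of [V] gives its upper bound. *)
    set (q := fun x => (E - V x) / (E - V xM)).
    assert (Hqm : forall x, 1 <= q x <= (E - V xm) / (E - V xM)).
    { intros x; destruct (Hbnd _ _ (unit_circle_punctured x)) as [B1 B2].
      change (V xm <= V x) in B1; change (V x <= V xM) in B2.
      unfold q; split.
      - apply Rle_div_r; lra.
      - apply Rmult_le_compat_r; [apply Rlt_le, Rinv_0_lt_compat|]; lra. }
    assert (Hq : forall x, continuous q x).
    { intros x; unfold q, Rdiv.
      apply (continuous_mult (fun x => E - V x)); [|apply continuous_const].
      apply (continuous_minus (V := R_NormedModule)); [apply continuous_const|apply Vc]. }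
    assert (Hqp : forall x, q (x + 1) = q x)
      by (intros x; unfold q, V; now rewrite circle_restriction_periodic).
    destruct (hill_periodic_data q _ Hq Hqm) as [w [u [p [Hw [Hup [Hu [Hp Hnz]]]]]]].
    assert (Hsq : 0 < sqrt (E - V xM)) by (apply sqrt_lt_R0; lra).
    assert (Hr : 0 < w / sqrt (E - V xM)) by now apply Rdiv_lt_0_compat.
    exists (w / sqrt (E - V xM)); split; [exact Hr|].
    exists (fun x => RtoC (u x)).
    apply (real_energy_eigenstate _ E _ u (fun x => w * p x) (fun x => w * (- w * q x * u x)));
      [exact Hr|apply Hup| | | |].
    + intros x; apply (is_derive_scal p), Hup.
    + intros x; rewrite circle_restriction_radial by assumption; fold V.
      (* With this radius [r ^ 2 * (E - V x) = w ^ 2 * q x], so the Hill equation is the eigenvalue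
         equation. *)
      replace ((w / sqrt (E - V xM)) ^ 2) with (w ^ 2 / (E - V xM)).
      * unfold q; field; lra.
      * rewrite <- (pow2_sqrt (E - V xM)) at 1 by lra; field; lra.
    + exact (hill_periodic q _ w u p Hqm Hqp Hup Hu Hp).
    + exact (hill_nonzero q w u p Hw Hup Hnz).
Qed.
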